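(* Let $G$ be a finite simple triangle-free graph with a proper edge-coloring, and let $\delta = \delta(G) \ge 1$ be its minimum degree. If $$|V(G)| > \frac{49}{8}\delta - \frac{21}{2} + \frac{9}{2\delta},$$ then $G$ contains a rainbow matching of size $\delta$.
   Context: All graphs are finite and simple. $\delta(G)$ denotes the minimum degree of $G$. A proper edge-coloring assigns a color to each edge so that any two distinct edges sharing an endpoint receive distinct colors (any number of colors may be used). A rainbow matching in an edge-colored graph is a matching (a set of pairwise disjoint edges) in which all edges have distinct colors; its size is its number of edges. *)

(* Defs.v *)
From mathcomp Require Import all_boot all_order all_algebra.

Set Implicit Arguments.
Unset Strict Implicit.
Unset Printing Implicit Defensive.

(* A finite simple graph is a symmetric irreflexive relation [e] on a finite
   type [T] of vertices; its edges are the two-element sets {x, y} with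
   [e x y]. *)

Definition edges (T : finType) (e : rel T) : {set {set T}} :=
  [set E | [exists x, exists y, e x y && (E == [set x; y])]].

Definition degree (T : finType) (e : rel T) (x : T) : nat :=
  #|[set y | e x y]|.

(* The default value #|T| does not affect the minimum when T is nonempty, since
   every degree is at most #|T|; the empty graph gets the value 0. *)
Definition min_degree (T : finType) (e : rel T) : nat :=
  \big[minn/#|T|]_(x : T) degree e x.

Definition triangle_free (T : finType) (e : rel T) : Prop :=
  forall x y z : T, ~ [/\ e x y, e y z & e x z].

(* A colouring is a function on all sets of vertices, of which only the values
   on the edges matter. *)
Definition proper_edge_coloring (T : finType) (e : rel T) (C : eqType)
    (c : {set T} -> C) : Prop :=
  forall E F : {set T}, E \in edges e -> F \in edges e ->
    E != F -> E :&: F != set0 -> c E != c F.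

Definition matching (T : finType) (e : rel T) (M : {set {set T}}) : Prop :=
  M \subset edges e /\ trivIset M.

Definition rainbow_matching (T : finType) (e : rel T) (C : eqType)
    (c : {set T} -> C) (M : {set {set T}}) : Prop :=
  matching e M /\ {in M &, injective c}.

(* Main.v *)
Require Import Defs.
From mathcomp Require Import all_boot all_order all_algebra.
From mathcomp Require Import zify ring.
Import Order.TTheory GRing.Theory Num.Theory.

(** Write [delta = k + 1].  It is enough that more than [k (6 k + 2) / (k + 1)]
    vertices have degree at least [delta]; this is weaker than the assumed bound
    on the order by [(delta - 2)^2 / (8 delta)].  The proof is by induction on
    [k].

    A vertex [v] of degree above [3 k] can be deleted: a rainbow matching of size
    [k] in the rest covers [2 k] vertices and uses [k] colours, so some edge at [v]
    extends it.  A colour with more than [2 k] edges can be deleted likewise.  So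
    all degrees are at most [3 k], all colour classes have at most [2 k] edges, and
    there is a rainbow matching [M] of size [k]; suppose none is larger, and let
    [W] be the set of vertices that [M] does not cover.

    Call a set [S] of edges of [M] good if each of its edges has an end, its hub,
    with at least [2 k + 3] neighbours in [W] along colours that do not occur in
    [M] outside [S]; these colours are the released ones.  A good set can be
    removed from [M], and after a small exchange among the remaining edges the
    hubs can be rematched greedily along released colours
    ([augmentation_cost_gt4]).  So released colours behave like unused ones: an
    exchange that gains an edge while using released colours is impossible.  Fix a
    maximal good set [S].

    Now count the pairs [(w, v)] with [w] in [W] and [v] adjacent to [w].  Charge
    the pair to the edge of [M] with the colour of [wv] if that colour is not
    released, and otherwise to the edge of [M] that contains [v], which exists
    because no released edge lies inside [W].  An edge of [S] is charged only
    through its hub, hence at most [3 k] times.  An edge outside [S] is charged at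
    most [4 k] times ([card_charge]): the more edges of its colour have both ends
    in [W], the more exchanges are available, and the fewer released edges leave
    its ends; maximality of [S] bounds the latter by [2 k + 2] when there are no
    such edges.  Hence the degrees in [W] sum to at most [4 k^2].  But [W] misses
    only [2 k] vertices, and the assumption on the number of vertices of degree
    at least [k + 1] makes this sum larger. *)

Set Implicit Arguments.
Unset Strict Implicit.
Unset Printing Implicit Defensive.
Local Open Scope nat_scope.

(** * Rainbow matchings in properly coloured graphs *)

Section ProperlyColored.

Variables (T : finType) (e : rel T).
Hypotheses (e_sym : symmetric e) (e_irr : irreflexive e).
Variables (C : eqType) (c : {set T} -> C).
Hypothesis c_proper : proper_edge_coloring e c.

Lemma edgesP E :
  reflect (exists x y, e x y /\ E = [set x; y]) (E \in edges e).
Proof.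
rewrite inE; apply: (iffP existsP) => [[x /existsP[y /andP[exy /eqP->]]]|].
  by exists x, y.
by case=> x [y [exy ->]]; exists x; apply/existsP; exists y; rewrite exy eqxx.
Qed.

Lemma mem_edges x y : e x y -> [set x; y] \in edges e.
Proof. by move=> exy; apply/edgesP; exists x, y. Qed.

Lemma card_edge E : E \in edges e -> #|E| = 2.
Proof.
case/edgesP=> x [y [exy ->]]; rewrite cards2; case: eqP exy => // ->.
by rewrite e_irr.
Qed.

Lemma edge_at E x : E \in edges e -> x \in E -> exists2 y, e x y & E = [set x; y].
Proof.
case/edgesP=> a [b [eab ->]] /set2P[]->; first by exists b.
by exists a; rewrite ?(e_sym b) // setUC.
Qed.

Lemma same_color_meet E F x : E \in edges e -> F \in edges e ->
  x \in E -> x \in F -> c E = c F -> E = F.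
Proof.
move=> eE eF xE xF cEF; apply/eqP/negPn/negP => neq.
have meet : E :&: F != set0 by apply/set0Pn; exists x; rewrite inE xE.
by have := c_proper eE eF neq meet; rewrite cEF eqxx.
Qed.

Lemma set2_inj (x y z : T) : [set x; y] = [set x; z] -> x != y -> y = z.
Proof.
move=> eq nxy; have : y \in [set x; z] by rewrite -eq set22.
by case/set2P=> // yx; rewrite yx eqxx in nxy.
Qed.

Lemma edge_neq x y : e x y -> x != y.
Proof. by apply: contraTneq => ->; rewrite e_irr. Qed.

Lemma color_inj_at x y z : e x y -> e x z ->
  c [set x; y] = c [set x; z] -> y = z.
Proof.
move=> exy exz /(same_color_meet (mem_edges exy) (mem_edges exz) (set21 _ _)).
by move=> /(_ (set21 _ _)) /set2_inj; apply; apply: edge_neq.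
Qed.

Lemma card_cover_matching M : rainbow_matching e c M -> #|cover M| = 2 * #|M|.
Proof.
case=> [[sM /eqP <-] _]; rewrite mulnC -sum_nat_const; apply: eq_bigr => E EM.
by rewrite card_edge // (subsetP sM).
Qed.

Lemma rainbow_sub (M N : {set {set T}}) :
  N \subset M -> rainbow_matching e c M -> rainbow_matching e c N.
Proof.
move=> sNM [[sM tM] iM]; split; first split.
- exact: subset_trans sM.
- exact: trivIsetS tM.
- by move=> x y xN yN; apply: iM; apply: (subsetP sNM).
Qed.

Lemma rainbow_add M E : rainbow_matching e c M -> E \in edges e ->
    [disjoint E & cover M] -> {in M, forall F, c F != c E} ->
  rainbow_matching e c (E |: M) /\ #|E |: M| = #|M|.+1.
Proof.
case=> [[sM tM] iM] eE dE cE.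
have set0N : set0 \notin M.
  by apply/negP => /(subsetP sM) /card_edge; rewrite cards0.
have [|tEM ENM] := @trivIsetU1 _ E M _ tM set0N.
  move=> F FM; apply: disjointWr dE; exact: bigcup_sup.
split; last by rewrite cardsU1 ENM.
split; first by split=> //; rewrite subUset sub1set eE.
move=> F G /setU1P[->|FM] /setU1P[->|GM] //.
- by move/eqP; rewrite eq_sym (negPf (cE _ GM)).
- by move/eqP; rewrite (negPf (cE _ FM)).
- exact: iM.
Qed.

Definition nbrs_in (D : {set T}) (Q : pred C) (x : T) : {set T} :=
  [set w in D | e x w && Q (c [set x; w])].

(** At one vertex a proper colouring is injective, so each member of [P] spoils
    at most one neighbour of [x]. *)
Lemma card_nbrs_colored x (A : {set T}) (P : {set {set T}}) :
    {in A, forall w, e x w /\ exists2 F, F \in P & c F = c [set x; w]} ->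
  #|A| <= #|P|.
Proof.
move=> AP; pose col w := c [set x; w].
rewrite cardE -(size_map col) [#|P|]cardE -(size_map c).
apply: uniq_leq_size.
  rewrite map_inj_in_uniq ?enum_uniq // => w z.
  rewrite !mem_enum => /AP[exw _] /AP[exz _]; exact: color_inj_at.
move=> y /mapP[w]; rewrite mem_enum => /AP[_ [F FP cF]] {y}->.
by apply/mapP; exists F; rewrite ?mem_enum.
Qed.

(** Only the members of a matching whose colour satisfies [Q] can conflict with
    an edge whose colour satisfies [Q]; this is the number that enters the
    greedy bound. *)
Definition num_colored (Q : pred C) (P : {set {set T}}) : nat :=
  #|[set E in P | Q (c E)]|.

Lemma num_coloredU1 Q E P :
  num_colored Q (E |: P) <= Q (c E) + num_colored Q P.
Proof.
rewrite /num_colored; have [QE|QE] /= := boolP (Q (c E)).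
  rewrite -(cards1 E); apply: leq_trans (leq_card_setU _ _).1.
  apply/subset_leq_card/subsetP => F; rewrite !inE.
  by case/andP=> /orP[->//|->] ->; rewrite orbT.
apply/subset_leq_card/subsetP => F; rewrite !inE.
by case/andP=> /orP[/eqP-> /(negP QE)|-> ->].
Qed.

(** Match the vertices of [xs] one after the other into [D] along edges whose
    colour satisfies [Q].  A neighbour is lost when it is covered already or when
    its colour occurs already, and each new edge raises both counts by one, so
    the factor 2 and the slack 1 in the bound are what the last vertex needs. *)
Lemma greedy_extension (D : {set T}) (Q : pred C) (xs : seq T) (P : {set {set T}}) :
    rainbow_matching e c P -> uniq xs ->
    {in xs, forall x, x \notin D} -> {in xs, forall x, x \notin cover P} ->
    {in xs, forall x, 2 * size xs + #|D :&: cover P| + num_colored Q P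
                       <= #|nbrs_in D Q x|.+1} ->
  exists2 P', rainbow_matching e c P' & #|P'| = #|P| + size xs.
Proof.
elim: xs P => [|x xs IH] P rP /=; first by exists P; rewrite ?addn0.
case/andP=> xxs uxs xsD xsP large.
have [w wN /norP[wP wC]] : exists2 w, w \in nbrs_in D Q x &
    ~~ ((w \in cover P) || [exists F in P, c F == c [set x; w]]).
  apply/exists_inP; rewrite -negb_forall_in; apply/negP => /forall_inP all_bad.
  pose A := [set w in nbrs_in D Q x | [exists F in P, c F == c [set x; w]]].
  have cA : #|A| <= num_colored Q P.
    apply: (@card_nbrs_colored x) => w.
    rewrite !inE => /andP[/and3P[_ exw Qw] /exists_inP[F FP /eqP cF]].
    by split=> //; exists F; rewrite // inE FP cF.
  have sub : nbrs_in D Q x \subset (D :&: cover P) :|: A.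
    apply/subsetP => w wN; have := all_bad _ wN; rewrite inE in wN.
    have /and3P[wD exw Qw] := wN; rewrite !inE wD exw Qw /=.
    by case/orP=> ->; rewrite ?orbT.
  have := large x (mem_head _ _); have := subset_leq_card sub.
  have := (leq_card_setU (D :&: cover P) A).1; move: cA => /=; lia.
move: wN; rewrite inE => /and3P[wD exw Qw].
have xN := xsP _ (mem_head _ _).
have [||rP1 cP1] := @rainbow_add P [set x; w] rP (mem_edges exw).
- by rewrite disjoints_subset subUset !sub1set !inE xN.
- move=> F FP; apply: contra wC => cF; apply/exists_inP; by exists F.
have cov1 : cover ([set x; w] |: P) = [set x; w] :|: cover P.
  by rewrite /cover bigcup_setU big_set1.
have [|||P' rP' cP'] := IH _ rP1 uxs.
- by move=> y yxs; apply: xsD; rewrite inE yxs orbT.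
- move=> y yxs; have yx : y \in x :: xs by rewrite inE yxs orbT.
  rewrite cov1 !inE !negb_or (xsP _ yx) andbT; apply/andP; split.
    by apply: contraNneq xxs => <-.
  by apply: contraTneq wD => <-; apply: xsD.
- move=> y yxs; have yx : y \in x :: xs by rewrite inE yxs orbT.
  apply: leq_trans (large _ yx).
  have D1 : #|D :&: cover ([set x; w] |: P)| <= #|D :&: cover P|.+1.
    have xD := xsD _ (mem_head _ _).
    have -> : #|D :&: cover P|.+1 = 1 + #|D :&: cover P| by [].
    rewrite -(cards1 w); apply: leq_trans (leq_card_setU _ _).1.
    apply/subset_leq_card/subsetP => z; rewrite cov1 !inE.
    case/andP=> zD /orP[/orP[/eqP zx|->//]|->]; last by rewrite zD orbT.
    by rewrite zx (negPf xD) in zD.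
  have C1 := num_coloredU1 Q [set x; w] P.
  by apply: leq_trans (leq_add (leq_add (leqnn _) D1) C1) _; rewrite Qw; lia.
by exists P' => //; rewrite cP' cP1 addSnnS.
Qed.

End ProperlyColored.

(** For a rainbow matching [M], these are the colours an edge may have next to
    [M :\: S]: the colours of [S], which become available when [S] is given up,
    together with the colours that [M] does not use. *)
Definition released (T : finType) (C : eqType) (c : {set T} -> C)
    (M S : {set {set T}}) : pred C :=
  fun a => ~~ [exists E in M :\: S, c E == a].

(** * Augmenting a rainbow matching of maximum size *)

Section Augmentation.

Variables (T : finType) (e : rel T).
Hypotheses (e_sym : symmetric e) (e_irr : irreflexive e).
Hypothesis e_triangle_free : triangle_free e.
Variables (C : eqType) (c : {set T} -> C).
Hypothesis c_proper : proper_edge_coloring e c.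
Variables (k : nat) (M S : {set {set T}}) (h : {set T} -> T).
Hypotheses (M_rainbow : rainbow_matching e c M) (cardM : #|M| = k).
Hypothesis no_larger : forall P, rainbow_matching e c P -> #|P| <> k.+1.

Local Notation W := (~: cover M).
Local Notation Q := (released c M S).

Hypothesis sSM : S \subset M.
(** The edges of [S] can be given up cheaply: [h f] has so many neighbours
    outside [M] along released colours that it can be rematched after a small
    exchange elsewhere. *)
Hypothesis hub : {in S, forall f,
  h f \in f /\ 2 * k + 3 <= #|nbrs_in e c W Q (h f)|}.

Lemma matching_edge f : f \in M -> f \in edges e.
Proof. by case: M_rainbow => [[/subsetP sM _] _]; apply: sM. Qed.

Lemma notin_cover (N : {set {set T}}) f x :
  N \subset M -> f \in M -> f \notin N -> x \in f -> x \notin cover N.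
Proof.
move=> sNM fM fN xf; apply/bigcupP => -[g gN xg].
have gM := subsetP sNM _ gN; case: M_rainbow => [[_ /trivIsetP tM] _].
have fg : f != g by apply: contraNneq fN => ->.
by have /pred0P/(_ x) := tM _ _ fM gM fg; rewrite /= xf xg.
Qed.

Lemma outside_cover (N : {set {set T}}) x :
  N \subset M -> x \in W -> x \notin cover N.
Proof.
move=> sNM; rewrite inE; apply: contra => /bigcupP[g gN xg].
by apply/bigcupP; exists g; rewrite ?(subsetP sNM).
Qed.

Lemma hub_covered f : f \in S -> h f \in cover M.
Proof.
by move=> fS; apply/bigcupP; exists f; rewrite ?(subsetP sSM) ?(hub fS).1.
Qed.

Lemma hub_outside f w : f \in S -> w \in W -> h f != w.
Proof.
by move=> /hub_covered hM; rewrite inE; apply: contraNneq => <-.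
Qed.

Lemma hub_unmatched f g x : f \in S -> g \in M :\: S -> x \in g -> h f != x.
Proof.
move=> fS /setDP[gM gS] xg; apply: contraTneq (hub fS).1 => ->.
apply: contraNN (notin_cover sSM gM gS xg) => xf.
by apply/bigcupP; exists f.
Qed.

Lemma num_colored_kept (N : {set {set T}}) :
  N \subset M :\: S -> num_colored c Q N = 0.
Proof.
move=> sN; apply: eq_card0 => E; rewrite !inE; apply/negP => /andP[EN /negP[]].
by apply/exists_inP; exists E; rewrite ?(subsetP sN) //.
Qed.

(** If [P] replaces [M :\: S] and gains one edge, then rematching the hubs greedily
    would give a rainbow matching larger than [M], unless [P] obstructs the greedy
    choice.  At most [k] hubs have [2 * k + 3] choices each, so the obstruction
    must be at least 5. *)
Lemma augmentation_cost_gt4 P : rainbow_matching e c P -> #|P| + #|S| = k.+1 ->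
    {in S, forall f, h f \notin cover P} ->
  4 < #|W :&: cover P| + num_colored c Q P.
Proof.
move=> rP cP hP; rewrite ltnNge; apply/negP => small.
have cS : #|S| <= k by rewrite -cardM subset_leq_card.
have [||||P' rP' cP'] :=
  @greedy_extension _ _ e_irr _ _ c_proper W Q [seq h f | f <- enum S] P rP.
- rewrite map_inj_in_uniq ?enum_uniq // => f g; rewrite !mem_enum => fS gS eqh.
  apply: contraTeq (hub fS).1 => fg; rewrite eqh.
  have gM := subsetP sSM _ gS; have fM := subsetP sSM _ fS.
  have s1 : [set f] \subset M by rewrite sub1set.
  have := notin_cover s1 gM _ (hub gS).1; rewrite inE cover1; apply.
  by rewrite eq_sym.
- by move=> x /mapP[f]; rewrite mem_enum inE negbK => fS ->; apply: hub_covered.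
- by move=> x /mapP[f]; rewrite mem_enum => fS ->; apply: hP.
- move=> x /mapP[f]; rewrite mem_enum => fS ->; have [_ hlarge] := hub fS.
  rewrite size_map -cardE -addnA.
  by apply: leq_trans (leq_add (leq_mul (leqnn 2) cS) small) _; rewrite addnS.
by apply: (no_larger rP'); rewrite cP' size_map -cardE.
Qed.

Lemma disjoint_set2 (x y : T) (A : {set T}) :
  x \notin A -> y \notin A -> [disjoint [set x; y] & A].
Proof. by move=> xA yA; rewrite disjoints_subset subUset !sub1set !inE xA. Qed.

Lemma cover_add (E : {set T}) (N : {set {set T}}) :
  cover (E |: N) = E :|: cover N.
Proof. by rewrite /cover bigcup_setU big_set1. Qed.

(** Adding [E] to [M :\: S] occupies at most two vertices outside [M] and one
    released colour. *)
Lemma disjoint_edge_not_released E : E \in edges e ->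
  [disjoint E & cover (M :\: S)] ->
  {in S, forall f, h f \notin E} -> ~~ Q (c E).
Proof.
move=> eE dE hE; apply/negP => QE.
have rN := rainbow_sub (subsetDl M S) M_rainbow.
have [|rP cP] := rainbow_add e_irr rN eE dE.
  move=> F FN; apply: contraNneq QE => cF.
  by apply/exists_inP; exists F; rewrite // cF.
have := augmentation_cost_gt4 rP; rewrite cP cover_add.
have cN : #|M :\: S|.+1 + #|S| = k.+1.
  by rewrite cardsD (setIidPr sSM) addSn subnK ?cardM // -cardM subset_leq_card.
move=> /(_ cN) aug; have {}/aug : {in S, forall f, h f \notin E :|: cover (M :\: S)}.
  move=> f fS; rewrite inE negb_or hE //=; apply/bigcupP => -[g gN hg].
  by have := hub_unmatched fS gN hg; rewrite eqxx.
apply/negP; rewrite -leqNgt.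
have W2 : #|W :&: (E :|: cover (M :\: S))| <= 2.
  rewrite -(card_edge e_irr eE); apply/subset_leq_card/subsetP => x.
  rewrite !inE => /andP[xM /orP[//|/bigcupP[g /setDP[gM _] xg]]].
  by case/negP: xM; apply/bigcupP; exists g.
have := num_coloredU1 c Q E (M :\: S).
rewrite (@num_colored_kept (M :\: S)) // addn0 => N1.
by apply: leq_trans (leq_add W2 (leq_trans N1 (leq_b1 _))) _.
Qed.

(** Exchange [f] for [E1] and [E2]: each may reuse the colour of [f] or have a
    released colour, so only a common colour can prevent the gain of an edge. *)
Lemma disjoint_edges_same_color f E1 E2 :
    f \in M :\: S -> E1 \in edges e -> E2 \in edges e ->
    [disjoint E1 & E2] ->
    [disjoint E1 & cover (M :\: S :\ f)] ->
    [disjoint E2 & cover (M :\: S :\ f)] ->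
    {in S, forall g, h g \notin E1 :|: E2} ->
    (c E1 == c f) || Q (c E1) -> (c E2 == c f) || Q (c E2) ->
    #|W :&: (E1 :|: E2)| + (Q (c E1) + Q (c E2)) <= 4 ->
  c E1 = c E2.
Proof.
move=> fN eE1 eE2 d12 d1 d2 hE c1 c2 small; apply/eqP/negPn/negP => c12.
have sN : M :\: S :\ f \subset M :\: S by apply: subsetDl.
have sNM := subset_trans sN (subsetDl M S).
have rN := rainbow_sub sNM M_rainbow.
have newc E F : (c E == c f) || Q (c E) -> F \in M :\: S :\ f -> c F != c E.
  move=> cE /setD1P[Ff FN]; apply: contraTneq cE => <-.
  rewrite negb_or negbK; apply/andP; split; last first.
    by apply/exists_inP; exists F.
  apply: contraNneq Ff => cFf; case: M_rainbow => _ inj.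
  by rewrite (inj _ _ _ _ cFf) // (subsetP (subsetDl M S)).
have [|r1 n1] := rainbow_add e_irr rN eE1 d1; first by move=> F; apply: newc.
have [||rP cP] := rainbow_add e_irr r1 eE2.
- rewrite cover_add disjoints_subset setCU subsetI -!disjoints_subset d2.
  by rewrite disjoint_sym d12.
- by move=> F /setU1P[->//|]; apply: newc.
have := augmentation_cost_gt4 rP; rewrite cP n1 !cover_add.
have cN : (#|M :\: S :\ f|).+2 + #|S| = k.+1.
  have := cardsD1 f (M :\: S); rewrite fN add1n => /esym->.
  by rewrite cardsD (setIidPr sSM) addSn subnK ?cardM // -cardM subset_leq_card.
move=> /(_ cN) aug.
have {}/aug : {in S, forall g, h g \notin E2 :|: (E1 :|: cover (M :\: S :\ f))}.
  move=> g gS; rewrite setUA inE negb_or setUC hE //=; apply/bigcupP => -[F FN hF].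
  by have := hub_unmatched gS (subsetP sN _ FN) hF; rewrite eqxx.
apply/negP; rewrite -leqNgt; apply: leq_trans small; apply: leq_add.
  apply/subset_leq_card/subsetP => x.
  rewrite !inE => /andP[xM /or3P[->|->|/bigcupP[g gN xg]]]; rewrite ?orbT ?xM //.
  by case/negP: xM; apply/bigcupP; exists g; rewrite ?(subsetP sNM).
apply: leq_trans (num_coloredU1 _ _ _ _) _; rewrite [X in _ <= X]addnC leq_add2l.
by apply: leq_trans (num_coloredU1 _ _ _ _) _; rewrite (num_colored_kept sN) addn0.
Qed.

Lemma outside_edge_disjoint x w (N : {set {set T}}) :
  x \in W -> w \in W -> N \subset M ->
  [disjoint [set x; w] & cover N].
Proof. by move=> xW wW sN; rewrite disjoint_set2 ?outside_cover. Qed.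

Lemma inside_not_released w v : w \in W -> v \in W -> e w v -> ~~ Q (c [set w; v]).
Proof.
move=> wW vW ewv; apply: disjoint_edge_not_released; rewrite ?mem_edges //.
  by rewrite outside_edge_disjoint ?subsetDl.
by move=> f fS; rewrite !inE negb_or !hub_outside.
Qed.

(** Giving up [f] with the rest of [S] frees [y] as well as the hub. *)
Lemma partner_not_released f y w : f \in S -> y \in f -> y != h f -> w \in W ->
  e w y -> ~~ Q (c [set w; y]).
Proof.
move=> fS yf yh wW ewy; have fM := subsetP sSM _ fS.
apply: disjoint_edge_not_released; rewrite ?mem_edges //.
  apply: disjoint_set2; first by rewrite outside_cover ?subsetDl.
  by rewrite (notin_cover (subsetDl M S) fM) // inE fS.
move=> g gS; rewrite !inE negb_or hub_outside //=.
have [->|gf] := eqVneq g f; first by rewrite eq_sym.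
apply: contraTneq (hub gS).1 => ->; have := @notin_cover [set g] f y.
by rewrite cover1 inE eq_sym; apply; rewrite // sub1set (subsetP sSM).
Qed.

(** If [f] can be exchanged for [[set z; z']], of the same colour, then its end
    [x] becomes free, and a released edge from [x] to another vertex outside [M]
    would be a gain. *)
Lemma swap_inside f z z' x w : f \in M :\: S -> z \in W -> z' \in W ->
    e z z' -> c [set z; z'] = c f -> x \in f -> w \in W -> e w x ->
    Q (c [set w; x]) ->
  w \in [set z; z'].
Proof.
move=> fN zW z'W ez cz xf wW ewx Qw; have [fM fS] := setDP fN.
have sN : M :\: S :\ f \subset M.
  exact: subset_trans (subsetDl _ _) (subsetDl _ _).
have fNN : f \notin M :\: S :\ f by rewrite !inE eqxx.
have xW : x \in cover M by apply/bigcupP; exists f.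
have nQf : Q (c f) = false.
  by apply/negbTE; rewrite negbK; apply/exists_inP; exists f.
apply/negPn/negP => wz.
suff : c [set z; z'] = c [set w; x] by move=> E; rewrite -E cz nQf in Qw.
apply: (disjoint_edges_same_color fN (mem_edges ez) (mem_edges ewx)).
all: rewrite ?cz ?eqxx ?Qw ?orbT //.
- rewrite disjoint_sym; apply: disjoint_set2 => //.
  by apply: contraL xW => /set2P[]->; rewrite -in_setC.
- exact: outside_edge_disjoint.
- by apply: disjoint_set2; [apply: outside_cover | apply: notin_cover fM _ _].
- move=> g gS; rewrite !inE !negb_or (hub_unmatched gS fN xf).
  by rewrite (hub_outside gS zW) (hub_outside gS z'W) (hub_outside gS wW).
rewrite nQf /= add0n -[4]/(3 + 1) leq_add2r.
apply: (@leq_trans #|[set z; z'; w]|).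
  apply/subset_leq_card/subsetP => y; rewrite !inE.
  case/andP=> yM /orP[->//|/orP[->|/eqP yx]]; rewrite ?orbT //.
  by rewrite yx xW in yM.
apply: leq_trans (leq_card_setU _ _).1 _.
by rewrite cards1 cards2; case: (z != z').
Qed.

(** If the colours differed, [f] could be exchanged for the two edges.  These are
    disjoint because a common neighbour of [x] and [y] would close a triangle. *)
Lemma swap_ends f x y w w' : f \in M :\: S -> x \in f -> y \in f -> x != y ->
    w \in W -> w' \in W -> e w x -> e w' y ->
    Q (c [set w; x]) -> Q (c [set w'; y]) ->
  c [set w; x] = c [set w'; y].
Proof.
move=> fN xf yf xy wW w'W ewx ewy Qx Qy; have [fM fS] := setDP fN.
have sN : M :\: S :\ f \subset M.
  exact: subset_trans (subsetDl _ _) (subsetDl _ _).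
have fNN : f \notin M :\: S :\ f by rewrite !inE eqxx.
have exy : e x y.
  have [v exv fE] := edge_at e_sym (matching_edge fM) xf.
  by move: yf; rewrite fE => /set2P[yx|->//]; rewrite yx eqxx in xy.
have ww' : w != w'.
  apply/eqP => E; apply: (e_triangle_free (x := w) (y := x) (z := y)).
  by split=> //; rewrite E.
have inM u : u \in f -> u \in cover M by move=> uf; apply/bigcupP; exists f.
have ne u v : u \in W -> v \in f -> u != v.
  by rewrite inE => uW /inM; apply: contraTneq => <-.
apply: (disjoint_edges_same_color fN (mem_edges ewx) (mem_edges ewy)).
all: rewrite ?Qx ?Qy ?orbT //.
- apply: disjoint_set2; rewrite !inE negb_or; first by rewrite ww' ne.
  by rewrite xy andbT eq_sym ne.
- by apply: disjoint_set2; [apply: outside_cover | apply: notin_cover fM _ _].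
- by apply: disjoint_set2; [apply: outside_cover | apply: notin_cover fM _ _].
- move=> g gS; rewrite !inE !negb_or (hub_unmatched gS fN xf).
  by rewrite (hub_unmatched gS fN yf) (hub_outside gS wW) (hub_outside gS w'W).
rewrite -[4]/(2 + (1 + 1)) leq_add2r.
apply: (@leq_trans #|[set w; w']|); last by rewrite cards2; case: (_ != _).
apply/subset_leq_card/subsetP => v; rewrite !inE.
case/andP=> vM /orP[/orP[->//|/eqP vx]|/orP[->|/eqP vy]]; rewrite ?orbT //.
  by rewrite vx inM in vM.
by rewrite vy inM in vM.
Qed.

(** * Charging the edges at uncovered vertices *)

Hypothesis degree_le : forall x, degree e x <= 3 * k.
Hypothesis color_class_le :
  forall a, #|[set E in edges e | c E == a]| <= 2 * k.
(** The threshold is below the one for hubs: [S] cannot be enlarged by [f]. *)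
Hypothesis small_unmatched : forall f x, f \in M :\: S -> x \in f ->
  #|nbrs_in e c W (released c M (f |: S)) x| <= 2 * k + 2.

Definition pairs_of_color (f : {set T}) : {set T * T} :=
  [set p | [&& p.1 \in W, e p.1 p.2 & c [set p.1; p.2] == c f]].

Definition released_pairs (f : {set T}) : {set T * T} :=
  [set p | [&& p.1 \in W, e p.1 p.2, p.2 \in f & Q (c [set p.1; p.2])]].

Lemma card_released_hub f : f \in S -> #|released_pairs f| <= 3 * k.
Proof.
move=> fS; have sub p : p \in released_pairs f -> p.2 = h f.
  rewrite inE => /and4P[pW ep pf Qp]; apply/eqP; apply: contraTT Qp => ph.
  exact: partner_not_released fS pf ph pW ep.
rewrite -(card_in_imset (f := fst)); last first.
  by move=> [a b] [a' b'] /sub /= -> /sub /= -> ->.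
apply: leq_trans (degree_le (h f)); apply/subset_leq_card/subsetP.
move=> w /imsetP[p pR ->]; rewrite inE -(sub p pR) e_sym.
by move: pR; rewrite inE => /and4P[].
Qed.

Lemma pairs_of_color_inj1 f : {in pairs_of_color f &, injective fst}.
Proof.
move=> [a b] [a' b']; rewrite !inE /= => /and3P[_ eab /eqP cab].
case/and3P=> _ eab' /eqP cab' aa; rewrite -aa in eab' cab' *.
by rewrite (color_inj_at e_irr c_proper eab eab' _) // cab cab'.
Qed.

Lemma pairs_of_color_inj2 f : {in pairs_of_color f &, injective snd}.
Proof.
move=> [a b] [a' b']; rewrite !inE /= => /and3P[_ eab /eqP cab].
case/and3P=> _ eab' /eqP cab' bb; rewrite -bb in eab' cab' *.
rewrite e_sym setUC in eab cab; rewrite e_sym setUC in eab' cab'.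
by rewrite (color_inj_at e_irr c_proper eab eab' _) // cab cab'.
Qed.

(** The [2 * k] edges of one colour have at most [4 * k] ends in all. *)
Lemma card_pairs_of_color f : #|pairs_of_color f| <= 4 * k.
Proof.
rewrite -(card_in_imset (@pairs_of_color_inj1 f)).
pose K := [set E in edges e | c E == c f].
apply: (@leq_trans #|cover K|).
  apply/subset_leq_card/subsetP => w /imsetP[p]; rewrite inE.
  case/and3P=> _ ep cp ->; apply/bigcupP; exists [set p.1; p.2].
    by rewrite inE mem_edges.
  by rewrite set21.
apply: leq_trans (leq_card_cover K).1 _.
rewrite (eq_bigr (fun=> 2)); last first.
  by move=> E; rewrite inE => /andP[eE _]; apply: card_edge.
rewrite sum_nat_const; apply: leq_trans (leq_mul (color_class_le (c f)) (leqnn 2)) _.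
by rewrite mulnAC.
Qed.

(** An edge with the colour of [f] cannot meet [f]; so apart from [A], the second
    vertex is one of the [2 * k - 2] vertices covered by the other edges of [M]. *)
Lemma card_cross_pairs f (A : {set T}) : f \in M ->
    {in pairs_of_color f, forall p, p.2 \in W -> p.2 \in A} ->
  #|pairs_of_color f| + 2 <= #|A| + 2 * k.
Proof.
move=> fM hA; rewrite -(card_in_imset (@pairs_of_color_inj2 f)).
have sub : M :\ f \subset M by apply: subsetDl.
have cov : #|cover (M :\ f)| + 2 = 2 * k.
  rewrite (card_cover_matching e_irr (rainbow_sub sub M_rainbow)).
  by rewrite -cardM (cardsD1 f M) fM mulnDr addnC.
rewrite -cov addnA leq_add2r; apply: leq_trans (leq_card_setU _ _).1.
apply/subset_leq_card/subsetP => v /imsetP[p pf ->]; rewrite inE.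
have [pW|] := boolP (p.2 \in W); first by rewrite hA.
rewrite inE negbK => /bigcupP[g gM pg]; apply/orP; right.
apply/bigcupP; exists g => //; rewrite !inE gM andbT.
move: pf; rewrite inE => /and3P[pW ep /eqP cp].
apply: contraTneq pW => gf; rewrite gf in pg gM *; rewrite inE negbK.
apply/bigcupP; exists f => //.
have <- := same_color_meet c_proper (mem_edges ep) (matching_edge fM)
  (set22 _ _) pg cp.
by rewrite set21.
Qed.

Lemma card_released_inj f : f \in M ->
  {in released_pairs f &, injective snd} -> #|released_pairs f| <= 2.
Proof.
move=> fM inj; rewrite -(card_in_imset inj) -(card_edge e_irr (matching_edge fM)).
by apply/subset_leq_card/subsetP => v /imsetP[p]; rewrite inE => /and4P[_ _ pf _] ->.
Qed.

(** If all released edges leave [f] from one end, the bound is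
    [small_unmatched].  If both ends are used, [swap_ends] forces a single colour,
    which leaves one edge at each end. *)
Lemma card_released_unmatched f : f \in M :\: S ->
  #|released_pairs f| <= 2 * k + 2.
Proof.
move=> fN; have [fM fS] := setDP fN.
have [->|[p0 p0R]] := set_0Vmem (released_pairs f); first by rewrite cards0.
have [/forall_inP same|] := boolP [forall q in released_pairs f, q.2 == p0.2].
  have sub p : p \in released_pairs f -> p.2 = p0.2 by move=> /same/eqP.
  rewrite -(card_in_imset (f := fst)); last first.
    by move=> [a b] [a' b'] /sub /= -> /sub /= -> ->.
  have p0f : p0.2 \in f by move: p0R; rewrite inE => /and4P[].
  apply: leq_trans (small_unmatched fN p0f); apply/subset_leq_card/subsetP.
  move=> w /imsetP[p pR ->]; have := sub p pR; move: pR.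
  rewrite !inE e_sym setUC => /and4P[-> ep _ Qp] <-; rewrite ep /=.
  apply: contra Qp => /exists_inP[F]; rewrite !inE negb_or -andbA.
  case/and3P=> _ FS FM cF.
  by apply/exists_inP; exists F; rewrite // inE FS.
rewrite negb_forall_in => /exists_inP[q0 q0R q0p0].
apply: leq_trans (leq_addl (2 * k) 2); apply: card_released_inj => // p q pR qR pq.
(* A released pair [r] at the other end of [f] has, by [swap_ends], the colour
   of both [p] and [q]. *)
have [r rR rp] : exists2 r, r \in released_pairs f & p.2 != r.2.
  have [E|] := eqVneq p.2 p0.2; last by exists p0.
  by exists q0 => //; rewrite E eq_sym.
have col s : s \in released_pairs f -> s.2 = p.2 ->
    c [set s.1; s.2] = c [set r.1; r.2].
  move: rR; rewrite inE => /and4P[rW er rf Qr].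
  rewrite inE => /and4P[sW es sf Qs] sp.
  by apply: swap_ends fN sf rf _ sW rW es er Qs Qr; rewrite sp.
have := col p pR erefl; rewrite -(col q qR (esym pq)).
move: pR qR; rewrite !inE => /and4P[_ ep _ _] /and4P[_ eq _ _].
case: p q pq ep eq {rp col} => [a x] [b y] /= -> eax ebx.
rewrite ![[set _; y]]setUC => cab; rewrite e_sym in eax; rewrite e_sym in ebx.
by rewrite (color_inj_at e_irr c_proper eax ebx cab).
Qed.

(** With no released edge, counting the colour class is enough.  With a released
    edge and some edge of the colour of [f] between uncovered vertices,
    [swap_inside] shows that the latter edge is unique and contains every
    uncovered end of a released edge; triangle-freeness then leaves one released
    edge per end of [f].  In the last case the colour of [f] contributes at most
    [2 * k - 2] and the released edges at most [2 * k + 2]. *)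
Lemma card_charge f : f \in M :\: S ->
  #|pairs_of_color f| + #|released_pairs f| <= 4 * k.
Proof.
move=> fN; have [fM fS] := setDP fN.
have k_gt0 : 0 < k by rewrite -cardM; apply/card_gt0P; exists f.
have [->|[p0 p0R]] := set_0Vmem (released_pairs f).
  by rewrite cards0 addn0 card_pairs_of_color.
have [/exists_inP[z zf zW]|] := boolP [exists z in pairs_of_color f, z.2 \in W];
    last first.
  rewrite negb_exists_in => /forall_inP noin.
  have := @card_cross_pairs f set0 fM; rewrite cards0 add0n.
  have noW : {in pairs_of_color f, forall p, p.2 \in W -> p.2 \in set0}.
    by move=> p pf pW; rewrite (negPf (noin p pf)) in pW.
  move=> /(_ noW) cA; have := card_released_unmatched fN; lia.
move: zf; rewrite inE => /and3P[z1W ez /eqP cz].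
have swap p : p \in released_pairs f -> p.1 \in [set z.1; z.2].
  by rewrite inE => /and4P[pW ep pf Qp]; apply: swap_inside fN _ _ _ _ pf _ ep Qp.
have cA : #|pairs_of_color f| <= 2 * k.
  have := @card_cross_pairs f [set z.1; z.2] fM.
  rewrite cards2 (edge_neq e_irr ez) addnC leq_add2l; apply => q.
  rewrite inE => /and3P[q1W eq /eqP cq] q2W.
  have /and4P[p0W ep0 p0f Qp0] : [&& p0.1 \in W, e p0.1 p0.2, p0.2 \in f
      & Q (c [set p0.1; p0.2])] by move: p0R; rewrite inE.
  have p0q := swap_inside fN q1W q2W eq cq p0f p0W ep0 Qp0.
  have -> := same_color_meet c_proper (mem_edges ez) (mem_edges eq)
    (swap _ p0R) p0q (etrans cz (esym cq)).
  exact: set22.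
have cB : #|released_pairs f| <= 2.
  apply: card_released_inj => // p q pR qR pq.
  have := swap _ pR; have := swap _ qR.
  move: pR qR; rewrite !inE => /and4P[_ ep _ _] /and4P[_ eq _ _].
  case: p q pq ep eq => [a x] [b y] /= -> eay eby.
  have [-> //|ab] := eqVneq a b => bz az.
  case: (e_triangle_free (x := z.1) (y := z.2) (z := y)); split=> //.
    by case/orP: az ab eay => /eqP->; case/orP: bz eby => /eqP-> //; rewrite eqxx.
  by case/orP: az ab eay => /eqP->; case/orP: bz eby => /eqP-> //; rewrite eqxx.
by apply: leq_trans (leq_add cA cB) _; lia.
Qed.

(** A pair is charged to the edge of [M :\: S] with its colour when this colour is
    not released, and otherwise to the edge of [M] covering its second vertex,
    which exists by [inside_not_released]. *)
Lemma card_outside_pairs :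
  #|[set p : T * T | p.1 \in W & e p.1 p.2]| <= k * (4 * k).
Proof.
pose charge f := if f \in S then released_pairs f
                 else pairs_of_color f :|: released_pairs f.
apply: (@leq_trans #|\bigcup_(f in M) charge f|).
  apply/subset_leq_card/subsetP => p; rewrite inE => /andP[pW ep].
  have [Qp|] := boolP (Q (c [set p.1; p.2])); last first.
    rewrite negbK => /exists_inP[f /setDP[fM fS] cf].
    apply/bigcupP; exists f => //.
    by rewrite /charge (negPf fS) !inE -in_setC pW ep eq_sym cf.
  have : p.2 \notin W by apply: contraL Qp => p2W; apply: inside_not_released.
  rewrite inE negbK => /bigcupP[f fM pf]; apply/bigcupP; exists f => //.
  have pR : p \in released_pairs f by rewrite inE pW ep pf.
  by rewrite /charge; case: (f \in S) => //; rewrite inE pR orbT.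
have chargeM f : f \in M -> #|charge f| <= 4 * k.
  move=> fM; rewrite /charge; have [fS|fS] := boolP (f \in S).
    by apply: leq_trans (card_released_hub fS) _; rewrite leq_mul2r orbT.
  by apply: leq_trans (leq_card_setU _ _).1 (card_charge _); rewrite inE fS.
rewrite -cardM -sum_nat_const; apply: (@leq_trans (\sum_(f in M) #|charge f|)).
  elim/big_rec2: _ => [|f n A _ le]; first by rewrite cards0.
  by apply: leq_trans (leq_card_setU _ _).1 _; rewrite leq_add2l.
by apply: leq_sum => f fM; rewrite cardM chargeM.
Qed.

End Augmentation.

(** * Counting and induction *)

Section MinimalCounterexample.

Variables (T : finType) (e : rel T).
Hypotheses (e_sym : symmetric e) (e_irr : irreflexive e).
Variables (C : eqType) (c : {set T} -> C).
Hypothesis c_proper : proper_edge_coloring e c.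

Lemma released_mono (M S S' : {set {set T}}) a :
  S \subset S' -> released c M S a -> released c M S' a.
Proof.
move=> sSS; apply: contraNN => /exists_inP[F /setDP[FM FS] cF].
by apply/exists_inP; exists F; rewrite // !inE FM (contra (subsetP sSS F)).
Qed.

(** Take [S] inclusion-maximal among the sets of edges each of which has an end
    with [2 * k + 3] neighbours along colours released by [S].  Enlarging [S] only
    releases more colours, so by maximality no end of an edge [f] outside [S]
    qualifies even when [f] is released too.  The vertex [x0] is only the default
    value of the choice function. *)
Lemma maximal_hub_set (M : {set {set T}}) k (x0 : T) :
  exists2 S : {set {set T}}, S \subset M & exists2 h : {set T} -> T,
    {in S, forall f, h f \in f /\
       2 * k + 3 <= #|nbrs_in e c (~: cover M) (released c M S) (h f)|} &
    forall f x, f \in M :\: S -> x \in f ->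
      #|nbrs_in e c (~: cover M) (released c M (f |: S)) x| <= 2 * k + 2.
Proof.
pose strong S x := 2 * k + 3 <= #|nbrs_in e c (~: cover M) (released c M S) x|.
pose ok (S : {set {set T}}) :=
  (S \subset M) && [forall f in S, [exists x in f, strong S x]].
have [|S /maxsetP[/andP[sSM /forall_inP okS] maxS]] := @ex_maxset _ ok.
  by exists set0; rewrite /ok sub0set; apply/forall_inP => f; rewrite inE.
exists S => //; exists (fun f : {set T} => odflt x0 [pick x in f | strong S x]).
  move=> f fS; case: pickP => [x /andP[] //|none].
  by have /exists_inP[x xf sx] := okS f fS; have := none x; rewrite xf sx.
move=> f x /setDP[fM fS] xf; rewrite leqNgt; apply/negP => large.
have mono g y : strong S y -> strong (g |: S) y.
  move=> /leq_trans; apply; apply/subset_leq_card/subsetP => w.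
  rewrite !inE => /and3P[-> -> Qw] /=.
  exact: released_mono (subsetUr _ _) Qw.
have okf : ok (f |: S).
  rewrite /ok subUset sub1set fM sSM; apply/forall_inP => g /setU1P[->|gS].
    by apply/exists_inP; exists x; rewrite // /strong addnS.
  have /exists_inP[y yg sy] := okS g gS.
  by apply/exists_inP; exists y => //; apply: mono.
by case/negP: fS; rewrite -(maxS _ okf (subsetUr _ _)) setU11.
Qed.

Lemma card_rel_pairs (W : {set T}) :
  #|[set p : T * T | p.1 \in W & e p.1 p.2]| = \sum_(w in W) degree e w.
Proof.
rewrite -sum1dep_card -(pair_big_dep (mem W) e (fun _ _ => 1)) /=.
by apply: eq_bigr => w _; rewrite sum1dep_card.
Qed.

(** At least [#|V| - 2 * k] vertices of degree above [k] are uncovered, and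
    [card_outside_pairs] bounds the sum of their degrees by [4 * k ^ 2]. *)
Lemma card_high_degree_le k (M : {set {set T}}) :
    triangle_free e -> rainbow_matching e c M -> #|M| = k ->
    (forall P, rainbow_matching e c P -> #|P| <> k.+1) ->
    (forall x, degree e x <= 3 * k) ->
    (forall a, #|[set E in edges e | c E == a]| <= 2 * k) ->
  k.+1 * #|[set x | k < degree e x]| <= k * (6 * k + 2).
Proof.
move=> e_tf rM cM nl deg cls; set V := [set x | _].
have [->|[x0 _]] := set_0Vmem V; first by rewrite cards0 muln0.
have [S sSM [h hub nohub]] := maximal_hub_set M k x0.
have := card_outside_pairs e_sym e_irr e_tf c_proper rM cM nl sSM hub deg cls nohub.
rewrite card_rel_pairs => up.
have low : k.+1 * #|V :&: ~: cover M| <= \sum_(w in ~: cover M) degree e w.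
  rewrite mulnC -sum_nat_const.
  rewrite [X in _ <= X](big_setID V) /= setIC; apply: leq_trans (leq_addr _ _).
  by apply: leq_sum => w; rewrite !inE => /andP[].
have cV : #|V| <= #|V :&: ~: cover M| + 2 * k.
  rewrite -[X in _ + 2 * X]cM -(card_cover_matching e_irr rM) -setDE.
  rewrite -(cardsID (cover M) V).
  by rewrite addnC leq_add2l subset_leq_card // subsetIr.
have := leq_trans low up; move: cV.
move: #|V| #|V :&: _| => v w; nia.
Qed.

Lemma edges_sub (e' : rel T) : subrel e' e -> edges e' \subset edges e.
Proof.
move=> sub; apply/subsetP => E /edgesP[x [y [exy ->]]].
by apply: mem_edges; apply: sub.
Qed.

Lemma rainbow_subrel (e' : rel T) M : subrel e' e ->
  rainbow_matching e' c M -> rainbow_matching e c M.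
Proof.
move=> sub [[sM tM] iM]; split=> //; split=> //.
exact: subset_trans (edges_sub sub).
Qed.

Lemma proper_subrel (e' : rel T) : subrel e' e -> proper_edge_coloring e' c.
Proof. by move=> /edges_sub/subsetP sub E F /sub eE /sub; apply: c_proper. Qed.

Lemma triangle_free_subrel (e' : rel T) :
  subrel e' e -> triangle_free e -> triangle_free e'.
Proof.
by move=> sub tf x y z [exy eyz exz]; apply: (tf x y z); split; apply: sub.
Qed.

(** Of the neighbours of [v], at most [2 * k] are covered by [M] and at most [k]
    are joined to [v] by an edge whose colour occurs in [M]. *)
Lemma rainbow_of_high_degree k (M : {set {set T}}) v :
    rainbow_matching e c M -> #|M| = k -> v \notin cover M ->
    3 * k < degree e v ->
  exists2 P, rainbow_matching e c P & #|P| = k.+1.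
Proof.
move=> rM cM vM dv.
have [||||P rP cP] := @greedy_extension _ _ e_irr _ _ c_proper
  [set~ v] predT [:: v] M rM.
- by [].
- by move=> x; rewrite !inE => /eqP->; rewrite eqxx.
- by move=> x; rewrite inE => /eqP->.
- move=> x; rewrite inE => /eqP->.
  have -> : nbrs_in e c [set~ v] predT v = [set y | e v y].
    by apply/setP => y; rewrite !inE andbT; case: eqVneq => // ->; rewrite e_irr.
  have n1 : #|[set~ v] :&: cover M| <= 2 * k.
    by rewrite -cM -(card_cover_matching e_irr rM) subset_leq_card ?subsetIr.
  have n2 : num_colored c predT M <= k.
    by rewrite -cM; apply/subset_leq_card/subsetP => E; rewrite inE => /andP[].
  apply: leq_trans (leq_add (leq_add (leqnn _) n1) n2) _.
  by move: dv; rewrite /degree /=; lia.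
by exists P => //; rewrite cP cM addn1.
Qed.

(** The edges of colour [a] are disjoint, so the [2 * k] vertices of [M] meet at
    most [2 * k] of them. *)
Lemma rainbow_of_large_color k (M : {set {set T}}) a :
    rainbow_matching e c M -> #|M| = k -> {in M, forall E, c E != a} ->
    2 * k < #|[set E in edges e | c E == a]| ->
  exists2 P, rainbow_matching e c P & #|P| = k.+1.
Proof.
move=> rM cM Ma; set K := [set E in edges e | _] => large.
have tK : trivIset K.
  apply/trivIsetP => E F; rewrite inE => /andP[eE /eqP cE].
  rewrite inE => /andP[eF /eqP cF].
  apply: contraNT => /pred0Pn[x /andP[/= xE xF]].
  by rewrite (same_color_meet c_proper eE eF xE xF) // cE cF.
have [E EK dE] : exists2 E, E \in K & [disjoint E & cover M].
  apply/exists_inP; apply: contraLR large => /exists_inPn no; rewrite -leqNgt.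
  rewrite -cM -(card_cover_matching e_irr rM).
  apply: leq_trans (leq_imset_card (pblock K) _).
  apply/subset_leq_card/subsetP => E EK.
  have /pred0Pn[x /andP[/= xE xM]] := no E EK.
  by apply/imsetP; exists x => //; rewrite (def_pblock tK EK xE).
move: EK; rewrite inE => /andP[eE /eqP cE].
have [|rP cP] := rainbow_add e_irr rM eE dE.
  by move=> F FM; rewrite cE Ma.
by exists (E |: M) => //; rewrite cP cM.
Qed.

End MinimalCounterexample.

(** Deleting a vertex of degree above [3 * k], or a colour with more than [2 * k]
    edges, lowers every other degree by at most one; the smaller matching found in
    the rest then extends.  Once neither is possible, the counting argument
    applies to a matching of size [k] of [e] itself. *)
Lemma rainbow_matching_step (T : finType) (C : eqType) (c : {set T} -> C)
    (k : nat) (e : rel T) (V : {set T}) :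
    symmetric e -> irreflexive e -> triangle_free e ->
    proper_edge_coloring e c -> {in V, forall x, k < degree e x} ->
    k * (6 * k + 2) < k.+1 * #|V| ->
    (forall (e' : rel T) (A : {set T}), symmetric e' -> subrel e' e ->
       #|V| <= #|A|.+1 -> {in A, forall x, k <= degree e' x} ->
       exists2 M, rainbow_matching e' c M & #|M| = k) ->
  exists2 M, rainbow_matching e c M & #|M| = k.+1.
Proof.
move=> e_sym e_irr e_tf c_proper Vdeg large smaller.
(* Deciding whether a larger rainbow matching exists keeps the argument by
   contradiction constructive. *)
pose rainbow (P : {set {set T}}) :=
  [&& P \subset edges e, trivIset P & dinjectiveb c P].
have rainbowP P : reflect (rainbow_matching e c P) (rainbow P).
  apply: (iffP and3P) => [[sP tP /dinjectiveP iP] //|[[sP tP] /dinjectiveP iP]].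
  by split.
have [/existsP[P /andP[/rainbowP rP /eqP cP]]|] :=
  boolP [exists P, rainbow P && (#|P| == k.+1)]; first by exists P.
rewrite negb_exists => /forallP no_larger.
have nl P : rainbow_matching e c P -> #|P| <> k.+1.
  by move=> /rainbowP rP /eqP cP; have := no_larger P; rewrite rP cP.
have deg x : degree e x <= 3 * k.
  rewrite leqNgt; apply/negP => dx.
  pose e' := [rel y z | [&& e y z, y != x & z != x]].
  have sub : subrel e' e by move=> y z /and3P[].
  have [||y|M rM cM] := smaller e' (V :\ x) _ sub.
  - by move=> y z /=; rewrite e_sym; congr (_ && _); rewrite andbC.
  - by have := cardsD1 x V; case: (x \in V) => ->; rewrite ?add1n ?leqnSn.
  - rewrite !inE => /andP[yx /Vdeg]; rewrite /degree [X in _ < X](cardsD1 x).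
    have -> : [set z | e' y z] = [set z | e y z] :\ x.
      by apply/setP => z; rewrite !inE yx andbC.
    by case: (x \in _) => //= /ltnW.
  have xM : x \notin cover M.
    apply/bigcupP => -[E EM xE]; have [[/subsetP sM _] _] := rM.
    have /edgesP[y [z [/and3P[_ yx zx] EE]]] := sM _ EM.
    by move: xE; rewrite EE !inE eq_sym (negPf yx) eq_sym (negPf zx).
  have [P rP cP] := rainbow_of_high_degree e_irr c_proper
    (rainbow_subrel sub rM) cM xM dx.
  exact: nl rP cP.
have cls a : #|[set E in edges e | c E == a]| <= 2 * k.
  rewrite leqNgt; apply/negP => da.
  pose e' := [rel y z | e y z && (c [set y; z] != a)].
  have sub : subrel e' e by move=> y z /andP[].
  have [||y yV|M rM cM] := smaller e' V _ sub.
  - by move=> y z /=; rewrite e_sym setUC.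
  - exact: leqnSn.
  - have := Vdeg y yV; rewrite /degree -(cardsID [set z | c [set y; z] == a]).
    have -> : [set z | e y z] :\: [set z | c [set y; z] == a] = [set z | e' y z].
      by apply/setP => z; rewrite !inE andbC.
    suff lost : #|[set z | e y z] :&: [set z | c [set y; z] == a]| <= 1.
      by move=> lt; rewrite -ltnS; apply: leq_trans lt _; rewrite -add1n leq_add2r.
    apply/card_le1_eqP => z w; rewrite !inE => /andP[eyz /eqP cz] /andP[eyw /eqP cw].
    by apply: (color_inj_at e_irr c_proper eyw eyz); rewrite cw cz.
  have Ma : {in M, forall E, c E != a}.
    move=> E EM; have [[/subsetP sM _] _] := rM.
    by have /edgesP[y [z [/andP[_ ca] ->]]] := sM _ EM.
  have [P rP cP] := rainbow_of_large_color e_irr c_proper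
    (rainbow_subrel sub rM) cM Ma da.
  exact: nl rP cP.
have [||M rM cM] := smaller e V e_sym (fun x y => id).
- exact: leqnSn.
- by move=> x /Vdeg /ltnW.
have := card_high_degree_le e_sym e_irr c_proper e_tf rM cM nl deg cls.
rewrite leqNgt => /negP[]; apply: leq_trans large _; rewrite leq_mul2l /=.
by apply/subset_leq_card/subsetP => x /Vdeg; rewrite inE.
Qed.

(** Asking only for many vertices of large degree, instead of a minimum degree,
    is what lets a deleted vertex stay in the type as an isolated vertex. *)
Lemma many_high_degree_rainbow (T : finType) (C : eqType) (c : {set T} -> C)
    (k : nat) (e : rel T) (V : {set T}) :
    symmetric e -> irreflexive e -> triangle_free e ->
    proper_edge_coloring e c -> {in V, forall x, k < degree e x} ->
    k * (6 * k + 2) < k.+1 * #|V| ->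
  exists2 M, rainbow_matching e c M & #|M| = k.+1.
Proof.
elim: k e V => [|k IH] e V e_sym e_irr e_tf c_proper Vdeg large.
all: apply: (rainbow_matching_step e_sym e_irr e_tf c_proper Vdeg large).
  move=> e' A _ _ _ _; exists set0; last by rewrite cards0.
  split; last by move=> x y; rewrite inE.
  by split; [apply: sub0set | apply/trivIsetP => x y; rewrite inE].
move=> e' A e'_sym sub cA Adeg; apply: (IH e' A) => //.
- by move=> x; apply/negP => /sub; rewrite e_irr.
- exact: triangle_free_subrel e_tf.
- exact: proper_subrel sub.
move: cA large; move: #|A| #|V| => a v; nia.
Qed.

Lemma leq_min_degree (T : finType) (e : rel T) x : min_degree e <= degree e x.
Proof.
rewrite /min_degree; have := mem_index_enum x.
elim: (index_enum T) => // y s IH; rewrite inE big_cons geq_min.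
by case/predU1P=> [->|/IH->]; rewrite ?leqnn ?orbT.
Qed.

Local Open Scope ring_scope.

(** The two bounds, multiplied by [d], differ by [(d - 2) ^+ 2 / 8]. *)
Lemma order_bound (F : realFieldType) (d n : F) : 0 < d ->
    49 / 8 * d - 21 / 2 + 9 / (2 * d) < n ->
  (d - 1) * (6 * (d - 1) + 2) < d * n.
Proof.
move=> d_gt0 n_large; have d_neq0 : d != 0 by rewrite gt_eqF.
have : d * (49 / 8 * d - 21 / 2 + 9 / (2 * d)) < d * n by rewrite ltr_pM2l.
have -> : d * (49 / 8 * d - 21 / 2 + 9 / (2 * d))
        = (d - 1) * (6 * (d - 1) + 2) + (d - 2) ^+ 2 / 8.
  by field.
by apply: le_lt_trans; rewrite lerDl divr_ge0 ?sqr_ge0.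
Qed.

Theorem theorem2 (T : finType) (e : rel T)
    (e_sym : symmetric e) (e_irr : irreflexive e)
    (e_triangle_free : triangle_free e)
    (C : eqType) (c : {set T} -> C)
    (c_proper : proper_edge_coloring e c)
    (delta : nat) (delta_def : delta = min_degree e)
    (delta_ge1 : (1 <= delta)%N)
    (T_large : 49 / 8 * delta%:R - 21 / 2 + 9 / (2 * delta%:R)
               < #|T|%:R :> rat) :
  exists M : {set {set T}}, rainbow_matching e c M /\ #|M| = delta.
Proof.
move: T_large; rewrite -(prednK delta_ge1); move: delta.-1 (prednK delta_ge1).
move=> k kE T_large; have {}delta_def : k.+1 = min_degree e by rewrite kE.
have Vdeg : {in [set: T], forall x, (k < degree e x)%N}.
  by move=> x _; rewrite delta_def leq_min_degree.
have d_gt0 : 0 < k.+1%:R :> rat by rewrite ltr0n.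
have := order_bound d_gt0 T_large.
rewrite -addn1 natrD addrK -natrD addn1 -!natrM -natrD -natrM ltr_nat => bound.
rewrite -cardsT in bound.
have [M rM cM] :=
  many_high_degree_rainbow e_sym e_irr e_triangle_free c_proper Vdeg bound.
by exists M; split.
Qed.
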